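(* Let $f : \mathbb{R}^n \to \mathbb{R}$ be a function which is $1$-smooth with respect to the norm $\|\cdot\|_B$, where $B$ is an $n\times n$ real symmetric positive definite matrix with eigenvalues $\lambda_1\geq\dots\geq\lambda_n$. Let $1\leq\tau_1<\tau_2\leq n$, and let $f$ be strongly convex with respect to the norms $\|\cdot\|_{B_{\tau_1}}$ and $\|\cdot\|_{B_{\tau_2}}$ with moduli $\mu_{\tau_1}$ and $\mu_{\tau_2}$ respectively. Then $$\mu_{\tau_1} \leq \mu_{\tau_2} \leq R_\lambda(\tau_1,\tau_2)\,\mu_{\tau_1}, \qquad\text{where}\quad R_\lambda(\tau_1,\tau_2) := \frac{\sum_{i=\tau_1}^n\lambda_i}{\sum_{i=\tau_2}^n\lambda_i}.$$
   Context: Notation: $\langle\cdot,\cdot\rangle$ is the standard inner product on $\mathbb{R}^n$; for a symmetric positive semidefinite matrix $B$, $\|v\|_B := \langle Bv, v\rangle^{1/2}$. A differentiable function $f:\mathbb{R}^n\to\mathbb{R}$ is $1$-smooth with respect to $\|\cdot\|_B$ if $f(y) \leq f(x) + \langle \nabla f(x), y-x\rangle + \frac12\|y-x\|_B^2$ for all $x,y\in\mathbb{R}^n$. $\tau$-coordinate approximation: if $B = Q\operatorname{Diag}(\lambda_1,\dots,\lambda_n)Q^T$ with $Q$ orthogonal, then for $1\le\tau\le\operatorname{Rank}(B)$, $B_\tau := Q\operatorname{Diag}(\lambda_1,\dots,\lambda_\tau,\lambda_\tau,\dots,\lambda_\tau)Q^T + \left(\sum_{i=\tau+1}^n\lambda_i\right)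 I$, where $I$ is the identity matrix. It is positive definite and does not depend on the choice of $Q$. A differentiable function $f$ is strongly convex with respect to $\|\cdot\|_{B_\tau}$ if there is $\mu_\tau>0$ such that $f(y)\geq f(x)+\langle\nabla f(x),y-x\rangle+\frac{\mu_\tau}{2}\|y-x\|_{B_\tau}^2$ for all $x,y\in\mathbb{R}^n$; the largest such $\mu_\tau$ is called the modulus of strong convexity. *)

(* Defs.v *)
From HB Require Import structures.
From mathcomp Require Import all_boot all_order all_algebra.
From mathcomp Require Import all_classical all_reals all_analysis.
Set Implicit Arguments.
Unset Strict Implicit.
Unset Printing Implicit Defensive.
Import Order.TTheory GRing.Theory Num.Theory.
Import numFieldNormedType.Exports.
Local Open Scope ring_scope.

(* R^n is the space of column vectors 'cV[R]_n; its library norm is the max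
   norm, which in finite dimension yields the usual notion of
   differentiability. *)

Definition inner (R : realType) (n : nat) (u v : 'cV[R]_n) : R :=
  \sum_(i < n) u i 0 * v i 0.

Definition normB (R : realType) (n : nat) (B : 'M[R]_n) (v : 'cV[R]_n) : R :=
  Num.sqrt (inner (B *m v) v).

Definition gradient (R : realType) (n : nat) (f : 'cV[R]_n -> R)
  (x : 'cV[R]_n) : 'cV[R]_n := \col_(i < n) 'D_(delta_mx i 0) f x.

Definition pos_def (R : realType) (n : nat) (B : 'M[R]_n) : Prop :=
  B^T = B /\ forall v : 'cV[R]_n, v != 0 -> 0 < inner (B *m v) v.

Definition orthogonal_mx (R : realType) (n : nat) (Q : 'M[R]_n) : Prop :=
  Q *m Q^T = 1%:M.

(* Eigenvalues are indexed from 1: only lam 1, ..., lam n are used, and the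
   i-th diagonal entry (i counted from 0) is lam i.+1. *)
Definition eigendecomposition (R : realType) (n : nat) (B Q : 'M[R]_n)
    (lam : nat -> R) : Prop :=
  [/\ orthogonal_mx Q,
      B = Q *m diag_mx (\row_(i < n) lam i.+1) *m Q^T
    & forall i j : nat, (1 <= i)%N -> (i <= j)%N -> (j <= n)%N ->
        lam j <= lam i].

(* The tau-coordinate approximation of Q Diag(lam) Q^T; the entries
   lam (minn i.+1 tau) are lam_1, ..., lam_tau, lam_tau, ..., lam_tau. *)
Definition coord_approx (R : realType) (n : nat) (Q : 'M[R]_n)
    (lam : nat -> R) (tau : nat) : 'M[R]_n :=
  Q *m diag_mx (\row_(i < n) lam (minn i.+1 tau)) *m Q^T
  + (\sum_(tau.+1 <= i < n.+1) lam i)%:M.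

Definition one_smooth (R : realType) (n : nat) (B : 'M[R]_n)
    (f : 'cV[R]_n -> R) : Prop :=
  (forall x : 'cV[R]_n, differentiable f x) /\
  forall x y : 'cV[R]_n,
    f y <= f x + inner (gradient f x) (y - x) + 2^-1 * normB B (y - x) ^+ 2.

Definition strongly_convex_with (R : realType) (n : nat) (B : 'M[R]_n)
    (f : 'cV[R]_n -> R) (mu : R) : Prop :=
  [/\ 0 < mu,
      forall x : 'cV[R]_n, differentiable f x
    & forall x y : 'cV[R]_n,
        f x + inner (gradient f x) (y - x) + mu / 2 * normB B (y - x) ^+ 2
          <= f y].

Definition strong_convexity_modulus (R : realType) (n : nat) (B : 'M[R]_n)
    (f : 'cV[R]_n -> R) (mu : R) : Prop :=
  strongly_convex_with B f mu /\
  forall mu' : R, strongly_convex_with B f mu' -> mu' <= mu.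

Definition Rlambda (R : realType) (n : nat) (lam : nat -> R)
    (tau1 tau2 : nat) : R :=
  (\sum_(tau1 <= i < n.+1) lam i) / (\sum_(tau2 <= i < n.+1) lam i).

(* Main.v *)
(** The matrices [B_tau] are simultaneously diagonalized by [Q], so comparing
    their norms amounts to comparing the eigenvalues
    [lam_(min i tau) + \sum_(j > tau) lam_j].  These decrease with [tau], and
    those of [B_tau1] are at most [Rlambda n lam tau1 tau2] times those of
    [B_tau2]; maximality of the moduli turns the two comparisons of norms into
    the two inequalities. *)
Require Import Defs.
From mathcomp Require Import all_boot all_order all_algebra.
From mathcomp Require Import all_classical all_reals all_analysis.
From mathcomp Require Import ring lra.
Set Implicit Arguments.
Unset Strict Implicit.
Unset Printing Implicit Defensive.
Import Order.TTheory GRing.Theory Num.Theory.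
Local Open Scope ring_scope.

(** Regrouping [v^T Q D Q^T v] as [(Q^T v)^T D (Q^T v)] turns the form into a weighted sum of
    squares. *)
Lemma inner_conj_diag (R : realType) n (Q : 'M[R]_n) (d : 'rV[R]_n)
    (v : 'cV[R]_n) :
  inner (Q *m diag_mx d *m Q^T *m v) v =
  \sum_(i < n) d 0 i * (Q^T *m v) i 0 ^+ 2.
Proof.
have innerE (u w : 'cV[R]_n) : inner u w = (w^T *m u) 0 0.
  by rewrite mxE; apply: eq_bigr => i _; rewrite !mxE mulrC.
rewrite innerE -!mulmxA mulmxA -{1}(trmxK Q) -trmx_mul mxE.
apply: eq_bigr => i _; rewrite mul_diag_mx [_^T _ _]mxE [in LHS]mxE; ring.
Qed.

(** Orthogonality gives [c I = Q (c I) Q^T], so the scalar shift can be absorbed into the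
    diagonal. *)
Lemma coord_approx_conj (R : realType) n (Q : 'M[R]_n) (lam : nat -> R) tau :
  orthogonal_mx Q ->
  coord_approx Q lam tau =
  Q *m diag_mx (\row_(i < n)
    (lam (minn i.+1 tau) + \sum_(tau.+1 <= j < n.+1) lam j)) *m Q^T.
Proof.
rewrite /coord_approx => QQt; set c := \sum_(_ <= _ < _) _.
have -> : \row_(i < n) (lam (minn i.+1 tau) + c) =
          \row_(i < n) lam (minn i.+1 tau) + const_mx c.
  by apply/rowP => i; rewrite !mxE.
rewrite raddfD /= mulmxDr mulmxDl diag_const_mx [in RHS]scalar_mxC.
by rewrite -[c%:M *m _ *m _]mulmxA QQt mulmx1.
Qed.

Lemma eigenvalue_gt0 (R : realType) n (B Q : 'M[R]_n) (lam : nat -> R) :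
  pos_def B -> eigendecomposition B Q lam ->
  forall i, (0 < i <= n)%N -> 0 < lam i.
Proof.
case=> _ Bpos [QQt BE _] [//|i] /= ltin.
have QtQ : Q^T *m Q = 1%:M by apply: mulmx1C.
(* [Q *m e] is column [k] of [Q], a unit eigenvector; the quadratic form of [B] takes the value
   [lam k.+1] there. *)
pose k := Ordinal ltin; pose e : 'cV[R]_n := delta_mx k 0.
have eE j : e j 0 = (j == k)%:R by rewrite mxE eqxx andbT.
have Qe : Q^T *m (Q *m e) = e by rewrite mulmxA QtQ mul1mx.
have /Bpos : Q *m e != 0.
  apply: contraTneq isT => Qe0; move: Qe; rewrite Qe0 mulmx0 => /matrixP/(_ k 0).
  by rewrite eE eqxx mxE => /eqP; rewrite eq_sym oner_eq0.
rewrite BE inner_conj_diag Qe (bigD1 k) //= big1 => [|j /negPf jk].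
  by rewrite eE eqxx expr1n mulr1 addr0 mxE.
by rewrite eE jk expr0n mulr0.
Qed.

(** Both forms are sums over the same squares, so weights compare termwise. Nonnegative weights
    ensure that squaring [normB] undoes its square root. *)
Lemma normB_conj_diag_le (R : realType) n (Q : 'M[R]_n) (d e : 'rV[R]_n)
    (c : R) (v : 'cV[R]_n) :
  (forall i, 0 <= d 0 i) -> (forall i, 0 <= e 0 i) ->
  (forall i, d 0 i <= c * e 0 i) ->
  normB (Q *m diag_mx d *m Q^T) v ^+ 2 <=
  c * normB (Q *m diag_mx e *m Q^T) v ^+ 2.
Proof.
move=> d0 e0 dce; rewrite /normB !inner_conj_diag.
rewrite !sqr_sqrtr; first last.
- by apply: sumr_ge0 => i _; rewrite mulr_ge0 ?sqr_ge0.
- by apply: sumr_ge0 => i _; rewrite mulr_ge0 ?sqr_ge0.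
by rewrite mulr_sumr; apply: ler_sum => i _; rewrite mulrA ler_wpM2r ?sqr_ge0.
Qed.

(** The bound on norms makes [mu / c] an admissible constant for [C], hence at most the maximal one,
    [nu]. *)
Lemma modulus_le (R : realType) n (B C : 'M[R]_n) (f : 'cV[R]_n -> R)
    (c mu nu : R) : 0 < c ->
  (forall v, normB C v ^+ 2 <= c * normB B v ^+ 2) ->
  strongly_convex_with B f mu -> strong_convexity_modulus C f nu ->
  mu <= c * nu.
Proof.
move=> c0 CB [mu0 df fB] [_ numax]; rewrite mulrC -ler_pdivrMr //.
apply: numax; split=> [|//|x y]; first exact: divr_gt0.
apply: le_trans (fB x y); rewrite lerD2l.
have -> : mu / c / 2 = mu / 2 * c^-1 by ring.
rewrite -mulrA ler_wpM2l //; first by rewrite ltW ?divr_gt0.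
by rewrite mulrC ler_pdivrMr // mulrC.
Qed.

Section EigenvalueComparison.

Variables (R : realType) (n : nat) (lam : nat -> R) (tau1 tau2 : nat).
Hypothesis lam_gt0 : forall i, (0 < i <= n)%N -> 0 < lam i.
Hypothesis lam_le :
  forall i j, (1 <= i)%N -> (i <= j)%N -> (j <= n)%N -> lam j <= lam i.
Hypothesis tau1_gt0 : (1 <= tau1)%N.
Hypothesis ltn_tau : (tau1 < tau2)%N.
Hypothesis tau2_le : (tau2 <= n)%N.

Let tau1_le : (tau1 <= n)%N := leq_trans (ltnW ltn_tau) tau2_le.
Let tau2_gt0 : (1 <= tau2)%N := leq_trans tau1_gt0 (ltnW ltn_tau).

Let tail tau := \sum_(tau <= i < n.+1) lam i.
(** The eigenvalue of [coord_approx Q lam tau] on column [i] of [Q], with [i] counted from 0. *)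
Let approx_ev tau i := lam (minn i.+1 tau) + tail tau.+1.

Lemma tail_recl tau : (tau <= n)%N -> tail tau = lam tau + tail tau.+1.
Proof. by move=> le_n; rewrite /tail big_ltn. Qed.

Lemma tail_ge0 tau : (1 <= tau)%N -> 0 <= tail tau.
Proof.
move=> tau_gt0; rewrite /tail big_nat; apply: sumr_ge0 => i /andP[le_i lt_i].
by rewrite ltW // lam_gt0 // (leq_trans tau_gt0 le_i).
Qed.

Lemma tail_gt0 tau : (1 <= tau <= n)%N -> 0 < tail tau.
Proof.
move=> h; have /andP[_ le_n] := h.
by rewrite tail_recl // ltr_wpDr ?tail_ge0 ?lam_gt0.
Qed.

Lemma tail_le : tail tau2 <= tail tau1.+1.
Proof.
rewrite {2}/tail (big_cat_nat (n := tau2)) //=; last exact: leqW.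
rewrite lerDr big_nat; apply: sumr_ge0 => i /andP[le_i lt_i].
by rewrite ltW // lam_gt0 // (leq_trans _ le_i) //= (leq_trans (ltnW lt_i)).
Qed.

Lemma approx_ev_ge0 tau i : (1 <= tau <= n)%N -> 0 <= approx_ev tau i.
Proof.
case/andP=> tau_gt0 le_n; rewrite addr_ge0 ?tail_ge0 // ltW // lam_gt0 //.
by rewrite leq_min tau_gt0 /= geq_min le_n orbT.
Qed.

(** Raising [tau] raises the index in the first summand, where [lam] decreases, and shortens the
    tail of positive terms. *)
Lemma approx_ev_le i : approx_ev tau2 i <= approx_ev tau1 i.
Proof.
apply: lerD.
  apply: lam_le; first by rewrite leq_min tau1_gt0.
    by rewrite leq_min geq_minl geq_min (ltnW ltn_tau) orbT.
  by rewrite geq_min tau2_le orbT.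
by apply: le_trans tail_le; rewrite (tail_recl tau2_le) lerDr ltW ?lam_gt0 ?tau2_gt0.
Qed.

Lemma Rlambda_ge1 : 1 <= Rlambda n lam tau1 tau2.
Proof.
rewrite /Rlambda ler_pdivlMr ?mul1r; last by rewrite tail_gt0 ?tau2_gt0.
apply: le_trans tail_le _; rewrite -/(tail tau1) (tail_recl tau1_le) lerDr.
by rewrite ltW ?lam_gt0 ?tau1_gt0.
Qed.

(* The eigenvalues are [tail tau + e] with excess
   [e := lam (minn i.+1 tau) - lam tau >= 0]; the tails have ratio exactly
   [Rlambda], and the excess only grows from [tau1] to [tau2]. *)
Lemma approx_ev_le_Rlambda i :
  approx_ev tau1 i <= Rlambda n lam tau1 tau2 * approx_ev tau2 i.
Proof.
have r1 := Rlambda_ge1; set r := Rlambda _ _ _ _ in r1 *.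
have tails : tail tau1 = r * tail tau2.
  by rewrite /r /Rlambda divfK // gt_eqF // tail_gt0 ?tau2_gt0.
rewrite /approx_ev.
have -> : tail tau1.+1 = tail tau1 - lam tau1 by rewrite (tail_recl tau1_le); ring.
have -> : tail tau2.+1 = tail tau2 - lam tau2 by rewrite (tail_recl tau2_le); ring.
have e2 : lam tau2 <= lam (minn i.+1 tau2).
  by apply: lam_le; rewrite ?geq_minr // leq_min tau2_gt0.
have e12 : lam (minn i.+1 tau1) - lam tau1 <= lam (minn i.+1 tau2) - lam tau2.
  (* If [i.+1 <= tau1], both minima are [i.+1] and [lam tau2 <= lam tau1] suffices; otherwise the
     excess at [tau1] is zero. *)
  case: (leqP i.+1 tau1) => [le_i|lt_i].
    rewrite (minn_idPl (leq_trans le_i (ltnW ltn_tau))).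
    by rewrite lerD2l lerN2 lam_le // ltnW.
  by rewrite subrr subr_ge0.
(* The tails cancel, leaving [e1 <= r * e2] for the two excesses; it follows from [e1 <= e2] and
   [0 <= (r - 1) * e2]. *)
rewrite tails; nra.
Qed.

End EigenvalueComparison.

Theorem mainTheorem4 (R : realType) (n : nat) (f : 'cV[R]_n -> R)
  (B Q : 'M[R]_n) (lam : nat -> R) (tau1 tau2 : nat) (mu1 mu2 : R)
  (hB : pos_def B)
  (hlam : eigendecomposition B Q lam)
  (hf : one_smooth B f)
  (htau1 : (1 <= tau1)%N) (htau12 : (tau1 < tau2)%N) (htau2 : (tau2 <= n)%N)
  (hmu1 : strong_convexity_modulus (coord_approx Q lam tau1) f mu1)
  (hmu2 : strong_convexity_modulus (coord_approx Q lam tau2) f mu2) :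
  mu1 <= mu2 /\ mu2 <= Rlambda n lam tau1 tau2 * mu1.
Proof.
have lam_gt0 := eigenvalue_gt0 hB hlam; have [QQt _ lam_le] := hlam.
have tau1_n : (1 <= tau1 <= n)%N by rewrite htau1 (leq_trans (ltnW htau12)).
have tau2_n : (1 <= tau2 <= n)%N by rewrite htau2 (leq_trans htau1) // ltnW.
have [[sc1 _] [sc2 _]] := (hmu1, hmu2); split.
(* The norm for [tau2] is the smaller one, so the comparison constant is 1. *)
- rewrite -[leRHS]mul1r; apply: modulus_le ltr01 _ sc1 hmu2 => v.
  rewrite !coord_approx_conj //; apply: normB_conj_diag_le => i; rewrite !mxE.
  + exact: approx_ev_ge0.
  + exact: approx_ev_ge0.
  + by rewrite mul1r; apply: approx_ev_le.
(* The roles are exchanged, with [Rlambda n lam tau1 tau2] as comparison constant. *)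
- apply: modulus_le _ _ sc2 hmu1 => [|v].
    by apply: lt_le_trans ltr01 _; apply: Rlambda_ge1.
  rewrite !coord_approx_conj //; apply: normB_conj_diag_le => i; rewrite !mxE.
  + exact: approx_ev_ge0.
  + exact: approx_ev_ge0.
  + exact: approx_ev_le_Rlambda.
Qed.
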